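(* Let $S=\{w_1,\dots,w_k\}$ be a set of words over $\{U,D,H\}$ such that no $w_i$ is a proper (consecutive) subword of another word of $S$. Suppose that every cluster with respect to $S$ reduces to a single step and has depth greater than or equal to $-1$. Let $A_H(x,t,z)$ be the generating function of clusters reducing to a horizontal step, where $x$ marks length, $t$ marks the number of marked subwords of the cluster, and $z$ marks the number of letters $H$; let $A'_H(x,t,z)$ be the analogous generating function of clusters reducing to a horizontal step and having depth $0$; define $A_D,A'_D$ and $A_U,A'_U$ in the same way for clusters reducing to a down step and to an up step, respectively. Let $F(x,t,z)=\sum_{w}x^{|w|}t^{|w|_S}z^{|w|_H}$, the sum over all Motzkin words $w$. Then $$F(x,t+1,z)=\frac{2ys}{2(1-l')ys-y's'+y's'l+y's'\sqrt{(1-l)^2-4ys}},$$ where $l=xz+A_H(x,t,z)$, $l'=xz+A'_H(x,t,z)$, $y=x+A_U(x,t,z)$, $y'=x+A'_U(x,t,z)$, $s=x+A_D(x,t,z)$, $s'=x+A'_D(x,t,z)$.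
   Context: A Motzkin word of length $n$ is a word over $\{U,D,H\}$ which, drawn with $U=(1,1)$, $D=(1,-1)$, $H=(1,0)$ from the origin, ends at $(n,0)$ and never goes below the $x$-axis (the empty word included). For a word $w$: $|w|$ is its length, $|w|_H$ its number of letters $H$, and $|w|_S$ the total number of occurrences (at distinct positions) of words of $S$ as consecutive subwords of $w$. A marked subword of $w=a_1\cdots a_n$ is a pair $(i,v)$ with $v=a_ia_{i+1}\cdots a_{i+|v|-1}\in S$. A marked word is a word together with a (possibly empty) set of its marked subwords. A cluster is a marked word (with nonempty underlying word) that is not the concatenation of two nonempty marked words, i.e. its marked subwords cover the word and the chain of marked subwords overlaps so that it cannot be cut between two consecutive letters without cutting a marked subword. A word $w$ reduces to an up step, down step, horizontal step if $|w|_U-|w|_D$ equals $1,-1,0$ respectively; a cluster reduces to a step if its underlying word does. Depth of a word reducing to a single step: draw it from the origin and let $k$ be the minimal $y$-coordinate reached; the depth is $k$ if it reduces to an up or horizontal step and $k+1$ if it reduces to a down step. *)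

(* Defs.v *)
From HB Require Import structures.
From mathcomp Require Import all_boot all_order all_algebra.
From mathcomp Require Import finmap.
From mathcomp Require Import boolp zify.
Set Implicit Arguments.
Unset Strict Implicit.
Unset Printing Implicit Defensive.
Import Order.TTheory GRing.Theory Num.Theory.
Local Open Scope ring_scope.

(* Formal power series in one variable [x].  The record keeps this Cauchy     *)
(* product apart from the pointwise product on [nat -> R].                    *)

Record fps (R : Type) := Fps { fpscoef : nat -> R }.

HB.instance Definition _ (R : Type) := gen_eqMixin (fps R).
HB.instance Definition _ (R : Type) := gen_choiceMixin (fps R).

Lemma fpsP (R : Type) (f g : fps R) : fpscoef f =1 fpscoef g <-> f = g.
Proof. by split=> [|->//]; case: f g => [f] [g] /= /funext->. Qed.

Section FpsZmod.
Variable R : zmodType.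
Implicit Types f g h : fps R.

Definition fps_zero : fps R := Fps (fun=> 0).
Definition fps_opp f := Fps (fun n => - fpscoef f n).
Definition fps_add f g := Fps (fun n => fpscoef f n + fpscoef g n).

Lemma fps_addA : associative fps_add.
Proof. by move=> f g h; apply/fpsP => n /=; rewrite addrA. Qed.
Lemma fps_addC : commutative fps_add.
Proof. by move=> f g; apply/fpsP => n /=; rewrite addrC. Qed.
Lemma fps_add0 : left_id fps_zero fps_add.
Proof. by move=> f; apply/fpsP => n /=; rewrite add0r. Qed.
Lemma fps_addN : left_inverse fps_zero fps_opp fps_add.
Proof. by move=> f; apply/fpsP => n /=; rewrite addNr. Qed.

HB.instance Definition _ :=
  GRing.isZmodule.Build (fps R) fps_addA fps_addC fps_add0 fps_addN.

Lemma coef_fps0 n : fpscoef (0 : fps R) n = 0. Proof. by []. Qed.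
Lemma coef_fpsN f n : fpscoef (- f) n = - fpscoef f n. Proof. by []. Qed.
Lemma coef_fpsD f g n : fpscoef (f + g) n = fpscoef f n + fpscoef g n.
Proof. by []. Qed.
End FpsZmod.

Section FpsRing.
Variable R : comNzRingType.
Implicit Types f g h : fps R.

Definition fps_one : fps R := Fps (fun n => (n == 0%N)%:R).
Definition fps_mul f g :=
  Fps (fun n => \sum_(i < n.+1) fpscoef f i * fpscoef g (n - i)).

Definition fps_trunc m f : {poly R} := \poly_(i < m.+1) fpscoef f i.

Lemma coef_fps_trunc m f n : (n <= m)%N -> (fps_trunc m f)`_n = fpscoef f n.
Proof. by move=> le_nm; rewrite coef_poly ltnS le_nm. Qed.

Lemma fps_mul_trunc m f g n : (n <= m)%N ->
  fpscoef (fps_mul f g) n = (fps_trunc m f * fps_trunc m g)`_n.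
Proof.
move=> le_nm; rewrite coefM /=; apply: eq_bigr => i _.
have le_in : (i <= n)%N by rewrite -ltnS.
rewrite !coef_fps_trunc //; first exact: leq_trans (leq_subr _ _) le_nm.
exact: leq_trans le_in le_nm.
Qed.

Lemma coefM_low (p p' q q' : {poly R}) n :
  (forall i, (i <= n)%N -> p`_i = p'`_i) ->
  (forall i, (i <= n)%N -> q`_i = q'`_i) -> (p * q)`_n = (p' * q')`_n.
Proof.
move=> pp' qq'; rewrite !coefM; apply: eq_bigr => i _.
by rewrite pp' -1?ltnS// qq' // leq_subr.
Qed.

Lemma fps_mulC : commutative fps_mul.
Proof. by move=> f g; apply/fpsP => n; rewrite !(fps_mul_trunc _ _ (leqnn n)) mulrC. Qed.

Lemma fps_mulA : associative fps_mul.
Proof.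
move=> f g h; apply/fpsP => n; rewrite !(fps_mul_trunc _ _ (leqnn n)).
transitivity ((fps_trunc n f * (fps_trunc n g * fps_trunc n h))`_n).
  apply: coefM_low => // i lein.
  by rewrite coef_fps_trunc // (fps_mul_trunc _ _ lein).
rewrite mulrA; apply: coefM_low => // i lein.
by rewrite coef_fps_trunc // (fps_mul_trunc _ _ lein).
Qed.

Lemma fps_mul1 : left_id fps_one fps_mul.
Proof.
move=> f; apply/fpsP => n /=; rewrite big_ord_recl /= mul1r subn0 big1 ?addr0 //.
by move=> i _; rewrite mul0r.
Qed.

Lemma fps_mulDl : left_distributive fps_mul (@fps_add R).
Proof.
move=> f g h; apply/fpsP => n /=; rewrite -big_split /=.
by apply: eq_bigr => i _; rewrite mulrDl.
Qed.

Lemma fps_one_neq0 : fps_one != 0.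
Proof. by apply/eqP => /fpsP/(_ 0%N)/eqP; rewrite /= oner_eq0. Qed.

HB.instance Definition _ := GRing.Zmodule_isComNzRing.Build (fps R)
  fps_mulA fps_mulC fps_mul1 fps_mulDl fps_one_neq0.

Lemma coef_fps1 n : fpscoef (1 : fps R) n = (n == 0%N)%:R. Proof. by []. Qed.
Lemma coef_fpsM f g n :
  fpscoef (f * g) n = \sum_(i < n.+1) fpscoef f i * fpscoef g (n - i).
Proof. by []. Qed.

Definition fps_unit : {pred fps R} := fun f => `[< exists g, g * f = 1 >].

Definition fps_inv f : fps R :=
  if pselect (exists g, g * f = 1) is left ex_g then projT1 (cid ex_g) else f.

Lemma fps_mulVx : {in fps_unit, left_inverse 1 fps_inv *%R}.
Proof.
move=> f /asboolP ex_g; rewrite /fps_inv.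
by case: pselect => // ex_g'; case: (cid ex_g').
Qed.

Lemma fps_unitPl f g : g * f = 1 -> fps_unit f.
Proof. by move=> gf; apply/asboolP; exists g. Qed.

Lemma fps_invr_out : {in [predC fps_unit], fps_inv =1 id}.
Proof.
move=> f /negP nu; rewrite /fps_inv; case: pselect => // ex_g.
by case: nu; apply/asboolP.
Qed.

HB.instance Definition _ := GRing.ComNzRing_hasMulInverse.Build (fps R)
  fps_mulVx fps_unitPl fps_invr_out.

Definition fpsC (c : R) : fps R := Fps (fun n => if n == 0%N then c else 0).

Definition fpsX : fps R := Fps (fun n => (n == 1%N)%:R).

End FpsRing.

Section FpsIdomain.
Variable R : idomainType.

Lemma fps_integral : GRing.integral_domain_axiom (fps R).
Proof.
move=> f g fg0; apply/norP => -[f0 g0].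
have least (h : fps R) : h != 0 ->
    {m | fpscoef h m != 0 & forall k, (k < m)%N -> fpscoef h k = 0}.
  move=> h0; have ex_m : exists m, fpscoef h m != 0.
    apply: contrapT => nex; move/eqP: h0; apply; apply/fpsP => n.
    by apply/eqP; apply: contrapT => hn; apply: nex; exists n; apply/negP.
  case: (ex_minnP ex_m) => m hm min_m; exists m => // k ltkm.
  by apply/eqP; apply: contraLR ltkm => /min_m; rewrite -leqNgt.
have [a fa fmin] := least _ f0; have [b gb gmin] := least _ g0.
move/fpsP/(_ (a + b)%N)/eqP: fg0; rewrite coef_fpsM.
have lea : (a < (a + b).+1)%N by rewrite ltnS leq_addr.
rewrite (bigD1 (Ordinal lea)) //= addKn big1 ?addr0; last first.
  move=> i; rewrite -val_eqE /= neq_ltn => /orP[/fmin->|lt_ai].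
    by rewrite mul0r.
  rewrite gmin ?mulr0 // ltn_subLR; first by rewrite ltn_add2r.
  by rewrite -ltnS.
by rewrite mulf_eq0 (negPf fa) (negPf gb).
Qed.

HB.instance Definition _ :=
  GRing.ComUnitRing_isIntegral.Build (fps R) fps_integral.
End FpsIdomain.

Definition fps_map (R R' : Type) (phi : R -> R') (f : fps R) : fps R' :=
  Fps (fun n => phi (fpscoef f n)).

(* Square root of a series with constant coefficient 1: the root whose own    *)
(* constant coefficient is 1, obtained by solving [r * r = f] for             *)
(* coefficient n.                                                             *)
Section FpsSqrt.
Variable R : comUnitRingType.

Fixpoint fps_sqrt_seq (f : fps R) (n : nat) : seq R :=
  if n is m.+1 then
    let s := fps_sqrt_seq f m in
    rcons s (if m is 0 then 1 else
      2%:R^-1 * (fpscoef f m - \sum_(1 <= i < m) s`_i * s`_(m - i)))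
  else [::].

Definition fps_sqrt (f : fps R) : fps R := Fps (fun n => (fps_sqrt_seq f n.+1)`_n).

Lemma size_fps_sqrt_seq f n : size (fps_sqrt_seq f n) = n.
Proof. by elim: n => //= n IHn; rewrite size_rcons IHn. Qed.

Lemma nth_fps_sqrt_seq f n i : (i < n)%N ->
  (fps_sqrt_seq f n)`_i = fpscoef (fps_sqrt f) i.
Proof.
elim: n => // n IHn; rewrite ltnS leq_eqVlt => /orP[/eqP->//|ltin].
rewrite [fps_sqrt_seq _ _]/= nth_rcons size_fps_sqrt_seq ltin.
exact: IHn.
Qed.

Lemma fps_sqrt_coef0 f : fpscoef (fps_sqrt f) 0 = 1.
Proof. by []. Qed.

Lemma fps_sqrt_coefS f n : fpscoef (fps_sqrt f) n.+1 =
  2%:R^-1 * (fpscoef f n.+1 - \sum_(1 <= i < n.+1)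
    fpscoef (fps_sqrt f) i * fpscoef (fps_sqrt f) (n.+1 - i)).
Proof.
transitivity ((rcons (fps_sqrt_seq f n.+1) (2%:R^-1 * (fpscoef f n.+1 -
    \sum_(1 <= i < n.+1)
      (fps_sqrt_seq f n.+1)`_i * (fps_sqrt_seq f n.+1)`_(n.+1 - i))))`_n.+1).
  by [].
rewrite nth_rcons size_fps_sqrt_seq ltnn eqxx; congr (_ * (_ - _)).
rewrite !big_nat; apply: eq_bigr => i /andP[i_gt0 ltin].
by rewrite !nth_fps_sqrt_seq // ltn_subrL i_gt0.
Qed.

Lemma fps_sqrt_sqr f : 2%:R \is a @GRing.unit R -> fpscoef f 0 = 1 ->
  fps_sqrt f ^+ 2 = f.
Proof.
move=> u2 f0; apply/fpsP => -[|n]; rewrite expr2 coef_fpsM.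
  by rewrite big_ord1 subn0 !fps_sqrt_coef0 mulr1 f0.
rewrite -(big_mkord xpredT (fun i =>
  fpscoef (fps_sqrt f) i * fpscoef (fps_sqrt f) (n.+1 - i))).
rewrite big_nat_recl // big_nat_recr // subn0 subnn fps_sqrt_coef0 mul1r mulr1.
rewrite addrCA -mulr2n -[_ *+ 2]mulr_natl fps_sqrt_coefS mulVKr //.
by rewrite big_add1 addrC subrK.
Qed.
End FpsSqrt.

(* Coefficient ring of the generating functions: the outer variable of        *)
(* [{poly {poly rat}}] is [t], the inner one is [z].                          *)

Notation Qtz := {poly {poly rat}}.

Lemma Qtz_unit2 : 2%:R \is a @GRing.unit Qtz.
Proof.
rewrite -polyC_natr poly_unitE coefC /= -polyC_natr size_polyC polyC_eq0.
by rewrite poly_unitE coefC size_polyC.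
Qed.

Definition tz_monom (a b : nat) : Qtz := 'X ^+ a * ('X ^+ b)%:P.

Definition zvar : fps Qtz := fpsC (tz_monom 0 1).
Definition xvar : fps Qtz := fpsX Qtz.

(* G(x, t, z) |-> G(x, t + 1, z).                                             *)
Definition shift_t (G : fps Qtz) : fps Qtz :=
  fps_map (fun p : Qtz => p \Po ('X + 1)) G.

Inductive letter := U | D | H.

Definition ord_of_letter (a : letter) : 'I_3 :=
  match a with U => inord 0 | D => inord 1 | H => inord 2 end.
Definition letter_of_ord (i : 'I_3) : letter :=
  match val i with 0%N => U | 1%N => D | _ => H end.
Lemma ord_of_letterK : cancel ord_of_letter letter_of_ord.
Proof. by case; rewrite /letter_of_ord /= inordK. Qed.
HB.instance Definition _ := Finite.copy letter (can_type ord_of_letterK).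

Notation word := (seq letter).

Definition height (w : word) : int :=
  (count_mem U w)%:Z - (count_mem D w)%:Z.

Definition motzkin (w : word) : bool :=
  (height w == 0) && all (fun i => 0 <= height (take i w)) (iota 0 (size w).+1).

(* The default value 0 is the height of the origin.                           *)
Definition min_height (w : word) : int :=
  \big[Num.min/0]_(i < (size w).+1) height (take i w).

Definition reduces_to_up (w : word) : bool := height w == 1.
Definition reduces_to_down (w : word) : bool := height w == -1.
Definition reduces_to_horizontal (w : word) : bool := height w == 0.
Definition reduces_to_step (w : word) : bool :=
  [|| reduces_to_up w, reduces_to_down w | reduces_to_horizontal w].

(* Meaningful only if [reduces_to_step w].                                    *)
Definition depth (w : word) : int :=
  if reduces_to_down w then min_height w + 1 else min_height w.

(* The marked subwords of [w]; positions are counted from 0.                  *)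
Definition occ (S : {fset word}) (w : word) : {fset nat * word} :=
  [fset p : nat * word in [seq (i, v) | i <- iota 0 (size w), v <- S]
     | take (size p.2) (drop p.1 w) == p.2]%fset.

(* The mark [(i, v)] occupies the positions i, ..., i + |v| - 1, and the cut  *)
(* before position [j] cuts it when i < j < i + |v|.                          *)
Definition cluster (S : {fset word}) (w : word) (M : {fset nat * word}) : bool :=
  [&& w != [::], (M `<=` occ S w)%fset,
      all (fun j => has (fun p : nat * word => (p.1 <= j < p.1 + size p.2)%N) M)
          (iota 0 (size w))
    & all (fun j => has (fun p : nat * word => (p.1 < j < p.1 + size p.2)%N) M)
          (iota 1 (size w).-1)].

(* The same notion in terms of concatenation of marked words: the unmarked    *)
(* one-letter words are the only indecomposable ones that are not clusters.   *)
Definition marks_cat (w1 : word) (M1 M2 : {fset nat * word}) : {fset nat * word} :=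
  (M1 `|` [fset (size w1 + p.1, p.2)%N | p in M2])%fset.

Definition decomposable (S : {fset word}) (w : word) (M : {fset nat * word}) : Prop :=
  exists w1 w2 M1 M2, [/\ w1 != [::], w2 != [::],
    (M1 `<=` occ S w1)%fset, (M2 `<=` occ S w2)%fset
    & w = w1 ++ w2 /\ M = marks_cat w1 M1 M2].

Lemma occP (S : {fset word}) (w : word) (p : nat * word) :
  reflect [/\ (p.1 < size w)%N, p.2 \in S & take (size p.2) (drop p.1 w) = p.2]
          (p \in occ S w).
Proof.
case: p => i v; rewrite !inE /=; apply: (iffP andP).
  case=> /allpairsP[[j u] /= [jw uS [-> ->]]] /eqP def_u.
  by split=> //; move: jw; rewrite mem_iota.
case=> lti vS ->; split=> //; apply/allpairsP; exists (i, v).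
by split=> //=; rewrite mem_iota.
Qed.

Lemma occ_bound (S : {fset word}) (w : word) (p : nat * word) :
  p \in occ S w -> (p.1 + size p.2 <= size w)%N.
Proof.
case/occP=> lti _ /(congr1 size); rewrite size_take size_drop; case: ifP; lia.
Qed.

Lemma clusterP (S : {fset word}) (w : word) (M : {fset nat * word}) :
  [::] \notin S ->
  cluster S w M <->
  [/\ w != [::], (M `<=` occ S w)%fset, M != fset0 & ~ decomposable S w M].
Proof.
move=> S0; split.
  case/and4P=> w0 MS /allP cov /allP cut; split=> //.
    have /cov/hasP[p pM _] : 0%N \in iota 0 (size w).
      by rewrite mem_iota; case: (w) w0.
    by apply/fset0Pn; exists p.
  case=> w1 [w2 [M1 [M2 [w10 w20 /fsubsetP s1 /fsubsetP s2 [defw defM]]]]].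
  have /cut/hasP[p] : size w1 \in iota 1 (size w).-1.
    rewrite mem_iota defw size_cat; case: (w1) w10 (w2) w20 => // ? ? _ [|? ?] //= _.
    by lia.
  rewrite defM => /fsetUP[/s1/occ_bound le|/imfsetP[q _ ->] /=] /andP[].
    by move=> _ /leq_trans/(_ le); rewrite ltnn.
  by rewrite ltnNge leq_addr.
case=> w0 MS M0 ndec; have /fsubsetP sM := MS.
have cut j : (0 < j < size w)%N ->
    has (fun p : nat * word => (p.1 < j < p.1 + size p.2)%N) M.
  move=> jw; apply: contrapT => /negP/hasPn ncut; apply: ndec.
  exists (take j w), (drop j w), [fset p in M | (p.1 + size p.2 <= j)%N]%fset,
    [fset ((p.1 - j)%N, p.2) | p in M & (j <= p.1)%N]%fset.
  have szt : size (take j w) = j by rewrite size_take; case: ifP; lia.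
  split; last first.
  - split; first by rewrite cat_take_drop.
    apply/fsetP => p; apply/idP/fsetUP => [pM|[]].
    + have := ncut _ pM; case: (leqP (p.1 + size p.2) j) => [le _|lt nlt].
        by left; rewrite !inE pM le.
      right; apply/imfsetP; exists ((p.1 - j)%N, p.2).
        by apply/imfsetP; exists p => //; rewrite !inE pM /=; lia.
      by rewrite szt /= subnKC; [case: (p)|lia].
    + by rewrite !inE => /andP[].
    + case/imfsetP=> q /imfsetP[r]; rewrite !inE => /andP[rM le] -> ->.
      by rewrite szt /= subnKC //; case: (r) rM.
  - apply/fsubsetP => p /imfsetP[r rP ->]; rewrite !inE in rP.
    case/andP: rP => rM le.
    have /occP[lt vS def_v] := sM _ rM; apply/occP; split => //=.
      by rewrite size_drop; lia.
    by rewrite drop_drop subnK.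
  - apply/fsubsetP => p pP; rewrite !inE in pP; case/andP: pP => pM le.
    have /occP[lt vS def_v] := sM _ pM.
    have p20 : (0 < size p.2)%N by rewrite lt0n size_eq0; apply: contraNneq S0 => <-.
    have ltj : (p.1 < j)%N by apply: leq_trans le; rewrite -addn1 leq_add2l.
    apply/occP; split => //; first by rewrite szt.
    rewrite -[RHS]def_v -[in RHS](cat_take_drop j w) drop_cat szt.
    by rewrite ltj takel_cat // size_drop szt leq_subRL // ltnW.
  - by rewrite -size_eq0 size_drop -lt0n subn_gt0; case/andP: jw.
  - by rewrite -size_eq0 szt -lt0n; case/andP: jw.
apply/and4P; split=> //; last first.
  by apply/allP => j; rewrite mem_iota => ?; apply: cut; lia.
apply/allP => j; rewrite mem_iota add0n => /andP[_ ltj].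
have w_gt0 : (0 < size w)%N by lia.
have [j_gt0|j0] := ltnP 0 j.
  have /cut/hasP[p pM pj] : (0 < j < size w)%N by lia.
  by apply/hasP; exists p => //; lia.
have [w_gt1|w_le1] := ltnP 1 (size w).
  have /cut/hasP[p pM pj] : (0 < 1 < size w)%N by lia.
  by apply/hasP; exists p => //; lia.
have [p pM] := fset0Pn _ M0; have /occP[lt vS _] := sM _ pM.
have p20 : (0 < size p.2)%N by rewrite lt0n size_eq0; apply: contraNneq S0 => <-.
apply/hasP; exists p => //.
have -> : p.1 = 0%N by apply/eqP; rewrite -leqn0 -ltnS (leq_trans lt).
by move: j0; rewrite leqn0 => /eqP->.
Qed.

Definition cluster_gf (S : {fset word}) (P : pred word) : fps Qtz :=
  Fps (fun n => \sum_(w : n.-tuple letter | P w)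
    \sum_(M <- fpowerset (occ S w) | cluster S w M)
      tz_monom #|` M| (count_mem H w)).

(* Hence the radicand (1 - l)^2 - 4 y s has constant coefficient 1 and        *)
(* [fps_sqrt_sqr] applies to it.                                              *)
Lemma cluster_gf_coef0 (S : {fset word}) (P : pred word) :
  fpscoef (cluster_gf S P) 0 = 0.
Proof.
by rewrite /= big1 // => w _; rewrite big1 // => M; rewrite tuple0.
Qed.

Definition A_H S := cluster_gf S reduces_to_horizontal.
Definition A_D S := cluster_gf S reduces_to_down.
Definition A_U S := cluster_gf S reduces_to_up.
Definition A'_H S :=
  cluster_gf S (fun w => reduces_to_horizontal w && (depth w == 0)).
Definition A'_D S :=
  cluster_gf S (fun w => reduces_to_down w && (depth w == 0)).
Definition A'_U S :=
  cluster_gf S (fun w => reduces_to_up w && (depth w == 0)).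

Definition motzkin_gf (S : {fset word}) : fps Qtz :=
  Fps (fun n => \sum_(w : n.-tuple letter | motzkin w)
    tz_monom #|` occ S w| (count_mem H w)).

(* Main.v *)
Require Import Defs.
From mathcomp Require Import all_boot all_order all_algebra.
From mathcomp Require Import finmap.
From mathcomp Require Import zify ring.
Set Implicit Arguments.
Unset Strict Implicit.
Unset Printing Implicit Defensive.
Import Order.TTheory GRing.Theory Num.Theory.
Local Open Scope ring_scope.

(* Replacing t by t + 1 turns F into the generating function of marked Motzkin
   words.  Cutting a marked word at the first place where no mark is cut splits
   off a single letter or a cluster.  Each such block moves the path by at most
   one level, and by the depth hypothesis it always fits above the axis unless
   its lower endpoint is at level 0, where it fits exactly if its depth is 0.
   Hence the series N_h of marked paths from level h to level 0 satisfy
     N_0 = 1 + l' N_0 + y' N_1,   N_1 = s' N_0 + l N_1 + y N_2,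
     N_h = s N_(h-1) + l N_h + y N_(h+1)   for h > 1.
   Let r be the square root in the statement, so that
   (1 - l - r) (1 - l + r) = 4 y s.  The series
   e_h = 2 y N_(h+1) - (1 - l - r) N_h satisfy (1 - l + r) e_h = 2 y e_(h+1) for
   h > 0.  As y has no constant term while 1 - l + r has constant term 2, every
   e_h is divisible by all powers of x, hence zero.  Therefore
   (1 - l + r) N_1 = 2 s' N_0, that is 4 y s N_1 = 2 s' (1 - l - r) N_0, and the
   equation for N_0 gives the formula. *)

(** * Power series *)

Lemma coef_fps_sum (R : zmodType) (I : Type) (r : seq I) (f : I -> fps R) n :
  fpscoef (\sum_(i <- r) f i) n = \sum_(i <- r) fpscoef (f i) n.
Proof. exact: (big_morph _ (fun f g => coef_fpsD f g n) (coef_fps0 R n)). Qed.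

Lemma coef0_fpsM (R : comNzRingType) (f g : fps R) :
  fpscoef (f * g) 0 = fpscoef f 0 * fpscoef g 0.
Proof. by rewrite coef_fpsM big_ord1. Qed.

Lemma coef0_fps_natr (R : comNzRingType) k : fpscoef (k%:R : fps R) 0 = k%:R.
Proof. by elim: k => // k IHk; rewrite -natr1 coef_fpsD IHk -natr1. Qed.

Lemma fps_natr_neq0 (R : comNzRingType) k :
  k%:R != 0 :> R -> k%:R != 0 :> fps R.
Proof. by apply: contraNneq => k0; rewrite -coef0_fps_natr k0. Qed.

Lemma fpsC0 (R : comNzRingType) : fpsC 0 = 0 :> fps R.
Proof. by apply/fpsP => -[]. Qed.

Lemma fpsC1 (R : comNzRingType) : fpsC 1 = 1 :> fps R.
Proof. by apply/fpsP => -[]. Qed.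

Lemma coef_fpsMC (R : comNzRingType) (f : fps R) (c : R) n :
  fpscoef (f * fpsC c) n = fpscoef f n * c.
Proof.
rewrite mulrC coef_fpsM big_ord_recl /= subn0 big1 ?addr0 1?mulrC // => i _.
by rewrite mul0r.
Qed.

Lemma tofrac_div_eq (R : idomainType) (a b c : R) :
  b != 0 -> a * c = b -> tofrac a = tofrac b / tofrac c :> {fraction R}.
Proof.
move=> b0 acb; have c0 : c != 0.
  by apply: contraNneq b0 => c0; rewrite -acb c0 mulr0.
by rewrite -acb rmorphM mulfK // tofrac_eq0.
Qed.

Lemma fps_geometric_eq0 (R : idomainType) (p q : fps R) (e : nat -> fps R) :
  fpscoef p 0 = 0 -> fpscoef q 0 != 0 -> (forall h, q * e h = p * e h.+1) ->
  forall h, e h = 0.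
Proof.
move=> p0 q0 qe; suff coef_e n h : fpscoef (e h) n = 0.
  by move=> h; apply/fpsP => n; rewrite coef_e.
elim/ltn_ind: n h => n IHn h.
have coef_pe : fpscoef (p * e h.+1) n = 0.
  rewrite coef_fpsM big1 // => -[[|i] lti] _ /=; first by rewrite p0 mul0r.
  by rewrite IHn ?mulr0 //; lia.
move: coef_pe; rewrite -qe coef_fpsM big_ord_recl subn0 big1 => [|i _].
  by rewrite addr0 => /eqP; rewrite mulf_eq0 (negPf q0) => /eqP.
by rewrite IHn ?mulr0 //= /bump /=; have := ltn_ord i; lia.
Qed.

Section LevelRecurrence.
Variables (R : idomainType) (l y s r : fps R).
Hypotheses (two_neq0 : 2%:R != 0 :> R) (l0 : fpscoef l 0 = 0).
Hypotheses (y0 : fpscoef y 0 = 0) (r0 : fpscoef r 0 = 1).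
Hypothesis sqr_r : r ^+ 2 = (1 - l) ^+ 2 - 4%:R * y * s.

Lemma discriminant_factor : 4%:R * y * s = (1 - l - r) * (1 - l + r).
Proof. by transitivity ((1 - l) ^+ 2 - r ^+ 2); [rewrite sqr_r|]; ring. Qed.

(* Dividing the characteristic polynomial [y X ^ 2 - (1 - l) X + s] by its
   factor [2 y X - (1 - l - r)] leaves a geometric recurrence. *)
Lemma level_recurrence_ratio (N : nat -> fps R) :
  (forall h, N h.+1 = s * N h + l * N h.+1 + y * N h.+2) ->
  forall h, 2%:R * y * N h.+1 = (1 - l - r) * N h.
Proof.
move=> rec h; pose e k := 2%:R * y * N k.+1 - (1 - l - r) * N k.
suff: e h = 0 by move/subr0_eq.
apply: (@fps_geometric_eq0 _ (2%:R * y) (1 - l + r) e) => [||k].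
- by rewrite coef0_fpsM y0 mulr0.
- by rewrite !(coef_fpsD, coef_fpsN) coef_fps1 l0 r0 subr0.
transitivity (2%:R * y * (1 - l + r) * N k.+1 - 4%:R * y * s * N k).
  by rewrite discriminant_factor /e; ring.
transitivity (4%:R * y * (N k.+1 - s * N k - l * N k.+1)
              - 2%:R * y * (1 - l - r) * N k.+1); first by ring.
by rewrite {1}rec /e; ring.
Qed.

Lemma level_system_solution (l' y' s' : fps R) (N : nat -> fps R) :
  N 0%N = 1 + l' * N 0%N + y' * N 1%N ->
  N 1%N = s' * N 0%N + l * N 1%N + y * N 2%N ->
  (forall h, N h.+2 = s * N h.+1 + l * N h.+2 + y * N h.+3) ->
  N 0%N * (2%:R * (1 - l') * y * s - y' * s' + y' * s' * l + y' * s' * r)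
  = 2%:R * y * s.
Proof.
move=> N0 N1 /level_recurrence_ratio/(_ 0%N) ratio.
have N1_N0 : (1 - l + r) * N 1%N = 2%:R * s' * N 0%N.
  transitivity (2%:R * (N 1%N - l * N 1%N) - (1 - l - r) * N 1%N).
    by ring.
  by rewrite -ratio {1}N1; ring.
have ysN1 : 4%:R * y * s * N 1%N = 2%:R * s' * (1 - l - r) * N 0%N.
  by rewrite discriminant_factor -[LHS]mulrA N1_N0; ring.
apply: (mulfI (fps_natr_neq0 two_neq0)).
transitivity (4%:R * y * s * (N 0%N - l' * N 0%N)
              - y' * (2%:R * s' * (1 - l - r) * N 0%N)); first by ring.
by rewrite -ysN1 {1}N0; ring.
Qed.

End LevelRecurrence.

(** * Generating functions of words *)

Section WordSeries.
Variable T : finType.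

Lemma big_tuple0 (R : nmodType) (F : seq T -> R) :
  \sum_(w : 0.-tuple T) F w = F [::].
Proof. by rewrite (big_pred1 [tuple]) // => w; rewrite [w]tuple0 /= eqxx. Qed.

Lemma big_tuple_cons (R : nmodType) n (F : seq T -> R) :
  \sum_(w : n.+1.-tuple T) F w = \sum_a \sum_(w : n.-tuple T) F (a :: w).
Proof.
pose cons_pair (p : T * n.-tuple T) := [tuple of p.1 :: p.2].
pose uncons (w : n.+1.-tuple T) := (thead w, [tuple of behead w]).
rewrite pair_big /= (reindex cons_pair) //=; exists uncons => [[a w]|w] _ /=.
  by congr pair; apply/val_inj.
by rewrite /cons_pair -tuple_eta.
Qed.

Lemma big_tuple_take_drop (R : nmodType) n i (F : seq T -> seq T -> R) :
  (i <= n)%N ->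
  \sum_(w : n.-tuple T) F (take i w) (drop i w) =
  \sum_(u : i.-tuple T) \sum_(v : (n - i).-tuple T) F u v.
Proof.
elim: i n F => [|i IHi] n F.
  rewrite subn0 (big_tuple0 (fun u => \sum_(v : n.-tuple T) F u v)) => _.
  by apply: eq_bigr => w _; rewrite take0 drop0.
case: n => // n le_in.
rewrite (@big_tuple_cons _ n (fun w => F (take i.+1 w) (drop i.+1 w))).
rewrite (@big_tuple_cons _ i (fun u => \sum_(v : (n - i).-tuple T) F u v)).
by apply: eq_bigr => a _; apply: (IHi n (fun u => F (a :: u))).
Qed.

Definition word_gf (R : nmodType) (f : seq T -> R) : fps R :=
  Fps (fun n => \sum_(w : n.-tuple T) f w).

Lemma eq_word_gf (R : nmodType) (f g : seq T -> R) :
  f =1 g -> word_gf f = word_gf g.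
Proof. by move=> fg; apply/fpsP => n; apply: eq_bigr => w _. Qed.

Lemma word_gfD (R : zmodType) (f g : seq T -> R) :
  word_gf (fun w => f w + g w) = word_gf f + word_gf g.
Proof. by apply/fpsP => n; rewrite /= big_split. Qed.

Lemma word_gf_sum (R : zmodType) (I : Type) (r : seq I) (f : I -> seq T -> R) :
  word_gf (fun w => \sum_(i <- r) f i w) = \sum_(i <- r) word_gf (f i).
Proof. by apply/fpsP => n; rewrite coef_fps_sum exchange_big. Qed.

Lemma word_gf_nil (R : comNzRingType) (c : R) :
  word_gf (fun w => if w is [::] then c else 0) = fpsC c.
Proof.
set f := (f in word_gf f).
apply/fpsP => -[|n] /=; first exact: (big_tuple0 f).
by rewrite big1 // => w _; rewrite (tuple_eta w).
Qed.

Lemma word_gf_letter (R : comNzRingType) (c : T -> R) :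
  word_gf (fun w => if w is [:: a] then c a else 0) =
  fpsX R * fpsC (\sum_a c a).
Proof.
set f := (f in word_gf f).
apply/fpsP => n; rewrite coef_fpsMC; case: n => [|[|n]] /=.
- by rewrite mul0r (big_tuple0 f).
- rewrite mul1r (@big_tuple_cons _ 0 f); apply: eq_bigr => a _.
  exact: (big_tuple0 (fun w => f (a :: w))).
- by rewrite mul0r big1 // => w _; case/tupleP: w => a w; case/tupleP: w.
Qed.

Definition word_conv (R : comNzRingType) (f g : seq T -> R) (w : seq T) : R :=
  \sum_(i < (size w).+1) f (take i w) * g (drop i w).

Lemma word_gf_conv (R : comNzRingType) (f g : seq T -> R) :
  word_gf (word_conv f g) = word_gf f * word_gf g.
Proof.
apply/fpsP => n; rewrite coef_fpsM /=.
transitivity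
  (\sum_(w : n.-tuple T) \sum_(i < n.+1) f (take i w) * g (drop i w)).
  by apply: eq_bigr => w _; rewrite /word_conv size_tuple.
rewrite exchange_big; apply: eq_bigr => i _ /=.
rewrite (big_tuple_take_drop (fun u v => f u * g v)) -1?ltnS // mulr_suml.
by apply: eq_bigr => u _; rewrite mulr_sumr.
Qed.

End WordSeries.

(** * Marked words *)

Lemma sum_fpowerset_expr (K : choiceType) (R : comNzRingType) (x : R)
    (A : {fset K}) :
  \sum_(B <- fpowerset A) x ^+ #|` B| = (x + 1) ^+ #|` A|.
Proof.
rewrite big_imfset /= => [|X Y _ _ /fsetP eqXY]; last first.
  by apply/setP => y; have := eqXY (val y); rewrite !inE.
rewrite big_enum /= cardfE -prodr_const bigA_distr.
apply: eq_big => [X|X _]; first by rewrite powersetE subsetT.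
rewrite card_imfset /=; last exact: val_inj.
by rewrite -cardE -prodr_const -big_mkcond.
Qed.

Lemma sum_first_true (R : nmodType) (a : pred nat) n (x : R) :
  a n -> \sum_(i < n.+1 | a i && all (predC a) (iota 0 i)) x = x.
Proof.
move=> an; have [m am min_m] := ex_minnP (ex_intro a n an).
rewrite (big_pred1 (inord m)) // => i /=.
rewrite -val_eqE /= inordK ?ltnS ?min_m //.
apply/andP/eqP => [[ai /allP na]|->].
  apply/eqP; rewrite eqn_leq min_m // andbT leqNgt; apply/negP => lt_mi.
  by have := na m; rewrite mem_iota lt_mi /= am => /(_ isT).
split=> //; apply/allP => j; rewrite mem_iota => /= lt_jm.
by apply/negP => /min_m; rewrite leqNgt lt_jm.
Qed.

Lemma tz_monom00 : tz_monom 0 0 = 1.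
Proof. by rewrite /tz_monom !expr0 mulr1. Qed.

Lemma letter_eqE (a b : letter) :
  (a == b) = match a, b with U, U | D, D | H, H => true | _, _ => false end.
Proof. by apply/eqP; case: a; case: b. Qed.

Section MarkedWords.
Variable S : {fset word}.
Implicit Types (u v w x : word) (M : {fset nat * word}) (p : nat * word).

Definition cuts M j := has (fun p => p.1 < j < p.1 + size p.2)%N M.

Lemma occ_catl u v p : (p.1 < size u)%N -> (p.1 + size p.2 <= size u)%N ->
  (p \in occ S (u ++ v)) = (p \in occ S u).
Proof.
move=> lt_pu le_pu; have take_eq : take (size p.2) (drop p.1 (u ++ v)) =
    take (size p.2) (drop p.1 u).
  by rewrite drop_cat lt_pu takel_cat // size_drop; lia.
by apply/occP/occP; rewrite take_eq size_cat => -[_ pS defp]; split=> //; lia.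
Qed.

Lemma occ_catr u v i x :
  ((size u + i, x)%N \in occ S (u ++ v)) = ((i, x) \in occ S v).
Proof.
have drop_eq : drop (size u + i) (u ++ v) = drop i v.
  by rewrite drop_cat ltnNge leq_addr addKn.
by apply/occP/occP; rewrite /= drop_eq size_cat ltn_add2l.
Qed.

Lemma mem_marks_catl u M1 M2 p : (p.1 < size u)%N ->
  (p \in marks_cat u M1 M2) = (p \in M1).
Proof.
move=> lt_pu; rewrite in_fsetU; case: (p \in M1) => //=.
by apply/negP => /imfsetP[q _ defp]; move: lt_pu; rewrite defp /=; lia.
Qed.

Lemma mem_marks_catr u M1 M2 i x : (M1 `<=` occ S u)%fset ->
  ((size u + i, x)%N \in marks_cat u M1 M2) = ((i, x) \in M2).
Proof.
move=> /fsubsetP sub_u.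
rewrite in_fsetU orb_idl => [|/sub_u/occP[/= lt _ _]]; last by lia.
apply/imfsetP/idP => [[[j z] jM [/addnI-> ->]] //|ixM].
by exists (i, x).
Qed.

Lemma mark_lt_or_shift u p :
  (p.1 < size u)%N \/ exists i, p = (size u + i, p.2)%N.
Proof.
have [lt|le] := ltnP p.1 (size u); [by left|right].
by exists (p.1 - size u)%N; rewrite subnKC //; case: p {le}.
Qed.

Lemma mark_lt_size w M p : (M `<=` occ S w)%fset -> p \in M -> (p.1 < size w)%N.
Proof. by move=> /fsubsetP sM /sM/occP[]. Qed.

Lemma marks_cat_inj u v M1 M2 M1' M2' :
  (M1 `<=` occ S u)%fset -> (M1' `<=` occ S u)%fset ->
  marks_cat u M1 M2 = marks_cat u M1' M2' -> M1 = M1' /\ M2 = M2'.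
Proof.
move=> sub_u sub_u' eqM; split; apply/fsetP; [move=> p|move=> [i x]].
  have [lt|ge] := ltnP p.1 (size u).
    by rewrite -(mem_marks_catl _ M2 lt) eqM mem_marks_catl.
  apply/idP/idP => [/(mark_lt_size sub_u)|/(mark_lt_size sub_u')].
    by rewrite ltnNge ge.
  by rewrite ltnNge ge.
by rewrite -(mem_marks_catr M2 i x sub_u) eqM mem_marks_catr.
Qed.

Lemma marks_cat_sub_occ u v M1 M2 :
  (M1 `<=` occ S u)%fset -> (M2 `<=` occ S v)%fset ->
  (marks_cat u M1 M2 `<=` occ S (u ++ v))%fset.
Proof.
move=> sub_u /fsubsetP sub_v; apply/fsubsetP => p.
have [lt_pu|[i ->]] := mark_lt_or_shift u p; last first.
  by rewrite mem_marks_catr // occ_catr => /sub_v.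
rewrite mem_marks_catl // => pM; have pu := fsubsetP sub_u p pM.
by rewrite occ_catl // (occ_bound pu).
Qed.

Lemma cuts_marks_cat u M1 M2 j : (j <= size u)%N ->
  cuts (marks_cat u M1 M2) j = cuts M1 j.
Proof.
move=> le_ju; apply/hasP/hasP => -[p pM cutp]; exists p => //.
  by rewrite mem_marks_catl // in pM; lia.
by rewrite mem_marks_catl //; lia.
Qed.

Lemma cuts_size u M : (M `<=` occ S u)%fset -> cuts M (size u) = false.
Proof. by move=> /fsubsetP sM; apply/hasPn => p /sM/occ_bound; lia. Qed.

Lemma marks_cat_surj u v M :
  (M `<=` occ S (u ++ v))%fset -> ~~ cuts M (size u) ->
  exists M1 M2, [/\ (M1 `<=` occ S u)%fset, (M2 `<=` occ S v)%fset
                  & M = marks_cat u M1 M2].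
Proof.
move=> /fsubsetP sM /hasPn ncut.
have sub_u : (M `&` occ S u `<=` occ S u)%fset by apply: fsubsetIr.
exists (M `&` occ S u)%fset,
  [fset p in occ S v | (size u + p.1, p.2)%N \in M]%fset.
split=> //; first by apply/fsubsetP => p; rewrite !inE => /andP[].
apply/fsetP => p; have [lt_pu|[i ->]] := mark_lt_or_shift u p.
  rewrite mem_marks_catl // in_fsetI andb_idr // => pM.
  by rewrite -(occ_catl v) ?sM //; have := ncut p pM; lia.
by rewrite mem_marks_catr // in_fset inE andb_idl // => /sM; rewrite occ_catr.
Qed.

Lemma perm_marks_cat u v :
  perm_eq [seq M <- fpowerset (occ S (u ++ v)) | ~~ cuts M (size u)]
    [seq marks_cat u M1 M2 |
       M1 <- fpowerset (occ S u), M2 <- fpowerset (occ S v)].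
Proof.
apply: uniq_perm => [||M]; first by rewrite filter_uniq ?fset_uniq.
  apply: allpairs_uniq => [||[M1 M2] [M1' M2']]; rewrite ?fset_uniq //.
  move=> /allpairsP[[X Y] /= [Xu _ [-> ->]]].
  move=> /allpairsP[[X' Y'] /= [Xu' _ [-> ->]]].
  by rewrite !fpowersetE in Xu Xu' => /marks_cat_inj[] // -> ->.
rewrite mem_filter fpowersetE; apply/andP/allpairsP => [[ncut sM]|].
  have [M1 [M2 [sub_u sub_v ->]]] := marks_cat_surj sM ncut.
  by exists (M1, M2); rewrite !fpowersetE.
case=> -[M1 M2] /=; rewrite !fpowersetE => -[sub_u sub_v ->].
by rewrite cuts_marks_cat // cuts_size // marks_cat_sub_occ.
Qed.

Lemma card_marks_cat u M1 M2 : (M1 `<=` occ S u)%fset ->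
  #|` marks_cat u M1 M2| = (#|` M1| + #|` M2|)%N.
Proof.
move=> sub_u; rewrite /marks_cat cardfsU disjoint_fsetI0 ?cardfs0 ?subn0.
  by rewrite [in LHS]card_imfset //= => -[i x] [j z] /= [/addnI-> ->].
apply/fdisjointP => p /(mark_lt_size sub_u) lt_pu.
apply/negP => /imfsetP[q _ defp].
by rewrite defp /= in lt_pu; lia.
Qed.

Definition mark_weight w M : Qtz := tz_monom #|` M| (count_mem H w).

Lemma mark_weight_cat u v M1 M2 : (M1 `<=` occ S u)%fset ->
  mark_weight (u ++ v) (marks_cat u M1 M2) =
  mark_weight u M1 * mark_weight v M2.
Proof.
rewrite /mark_weight /tz_monom count_cat => /card_marks_cat->.
by rewrite !exprD rmorphM /= mulrACA.
Qed.

Definition block w M := (w != [::]) && all (cuts M) (iota 1 (size w).-1).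

Lemma block_marks_cat u M1 M2 : block u (marks_cat u M1 M2) = block u M1.
Proof.
congr (_ && _); apply: eq_in_all => j; rewrite mem_iota => le_ju.
by apply: cuts_marks_cat; lia.
Qed.

Definition marked_weight w : Qtz :=
  \sum_(M <- fpowerset (occ S w)) mark_weight w M.

Lemma marked_weightE w :
  marked_weight w = tz_monom #|` occ S w| (count_mem H w) \Po ('X + 1).
Proof.
rewrite /tz_monom comp_polyM comp_polyC rmorphXn /= comp_polyX.
by rewrite -sum_fpowerset_expr [RHS]mulr_suml.
Qed.

Definition block_weight w : Qtz :=
  \sum_(M <- fpowerset (occ S w) | block w M) mark_weight w M.

Definition cluster_weight w : Qtz :=
  \sum_(M <- fpowerset (occ S w) | cluster S w M) mark_weight w M.

Lemma block_marked_weight_mul u v :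
  \sum_(M <- fpowerset (occ S (u ++ v)) | ~~ cuts M (size u) && block u M)
     mark_weight (u ++ v) M = block_weight u * marked_weight v.
Proof.
rewrite -big_filter_cond (perm_big _ (perm_marks_cat u v)) big_mkcond.
rewrite big_allpairs_dep mulr_suml big_mkcond [RHS]big_mkcond !big_seq.
apply: eq_bigr => M1; rewrite fpowersetE => sub_u.
under eq_bigr do rewrite block_marks_cat.
case: ifP => _; last by rewrite big1.
by rewrite mulr_sumr; apply: eq_bigr => M2 _; apply: mark_weight_cat.
Qed.

Lemma occ_nil : occ S [::] = fset0.
Proof. by apply/fsetP => p; rewrite in_fset0; apply/negP => /occP[]. Qed.

Lemma marked_weight_nil : marked_weight [::] = 1.
Proof.
rewrite /marked_weight occ_nil fpowerset0 big_seq_fset1.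
by rewrite /mark_weight cardfs0 tz_monom00.
Qed.

Lemma block_weight_nil : block_weight [::] = 0.
Proof. by rewrite /block_weight big_pred0. Qed.

(* Sorting the marked words by the first position where no mark is cut. *)
Lemma marked_weight_conv w :
  marked_weight w =
  (if w is [::] then 1 else 0) + word_conv block_weight marked_weight w.
Proof.
case: w => [|a w']; rewrite /word_conv.
  by rewrite big_ord1 block_weight_nil mul0r addr0 marked_weight_nil.
rewrite add0r big_ord_recl take0 block_weight_nil mul0r add0r.
set w := a :: w'.
pose uncut M i := ~~ cuts M i.+1.
transitivity (\sum_(M <- fpowerset (occ S w))
    \sum_(i < size w | uncut M i && all (predC (uncut M)) (iota 0 i))
      mark_weight w M).
  rewrite /marked_weight !big_seq.
  apply: eq_bigr => M; rewrite fpowersetE => sM.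
  by rewrite sum_first_true // /uncut (cuts_size sM).
under eq_bigr do rewrite big_mkcond.
rewrite exchange_big /=; apply: eq_bigr => i _; rewrite -big_mkcond /= add0n.
have size_take_w : size (take i.+1 w) = i.+1 by rewrite size_takel.
rewrite -[a :: take i w']/(take i.+1 w) -[drop i w']/(drop i.+1 w).
rewrite -block_marked_weight_mul cat_take_drop size_take_w; apply: eq_bigl => M.
rewrite /block size_take_w /= (iotaDl 1 0) all_map; congr (_ && _).
by apply: eq_all => k /=; rewrite negbK.
Qed.

Hypothesis S_nonempty_words : [::] \notin S.

(* A cut that splits no mark would decompose the marked word. *)
Lemma cluster_block w M : (M `<=` occ S w)%fset ->
  cluster S w M = block w M && (M != fset0).
Proof.
move=> sM; apply/idP/andP => [clM|[/andP[w0 /allP cutM] M0]].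
  have [_ _ M0 _] := (clusterP _ _ S_nonempty_words).1 clM.
  by split=> //; case/and4P: clM => w0 _ _ cutM; apply/andP.
apply/clusterP => //; split=> //.
case=> u [v [M1 [M2 [u0 v0 sub_u _ [defw defM]]]]].
have /cutM : size u \in iota 1 (size w).-1.
  rewrite mem_iota defw size_cat.
  by case: (u) (v) u0 v0 => [|? ?] [|? ?] //= _ _; lia.
by rewrite defM cuts_marks_cat // (cuts_size sub_u).
Qed.

Definition letter_weight a : Qtz := if a is H then tz_monom 0 1 else 1.

Lemma block_weightE w :
  block_weight w =
  (if w is [:: a] then letter_weight a else 0) + cluster_weight w.
Proof.
rewrite /block_weight big_mkcond.
rewrite (bigD1_seq fset0) ?fset_uniq ?fpowersetE ?fsub0set //=.
congr (_ + _).
  case: w => [|a [|b w]] //; rewrite /mark_weight cardfs0 /= letter_eqE.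
  by case: a; rewrite ?tz_monom00.
rewrite -big_mkcondr big_seq_cond [RHS]big_seq_cond; apply: eq_bigl => M.
apply: andb_id2l; rewrite fpowersetE => sM.
by rewrite cluster_block // andbC.
Qed.

End MarkedWords.

(** * Paths between levels *)

Lemma height_cat u v : height (u ++ v) = height u + height v.
Proof. by rewrite /height !count_cat; lia. Qed.

Lemma height_letter a :
  height [:: a] = match a with U => 1 | D => -1 | H => 0 end.
Proof. by rewrite /height /= !letter_eqE; case: a. Qed.

Lemma min_heightP w (k : int) :
  reflect (forall i, (i <= size w)%N -> k <= height (take i w))
          (k <= min_height w).
Proof.
apply: (iffP (bigmin_geP _ _ _ _)) => [[_ le_k] i le_iw|le_k].
  by rewrite -ltnS in le_iw; exact: (le_k (Ordinal le_iw)).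
by split=> [|i _]; [have := le_k 0%N isT; rewrite take0|rewrite le_k // -ltnS].
Qed.

Lemma le_min_height_cat (k : int) u v :
  (k <= min_height (u ++ v)) =
  (k <= min_height u) && (k - height u <= min_height v).
Proof.
apply/min_heightP/andP => [le_k|[/min_heightP le_u /min_heightP le_v] i le_i].
  split; apply/min_heightP => i le_i.
    by have := le_k i; rewrite takel_cat // size_cat; apply; lia.
  have := le_k (size u + i)%N; rewrite takeD take_size_cat // drop_size_cat //.
  by rewrite size_cat height_cat lerBlDl; apply; lia.
rewrite take_cat; case: ltnP => [/ltnW/le_u//|le_ui].
by rewrite height_cat -lerBlDl le_v //; move: le_i; rewrite size_cat; lia.
Qed.

Lemma min_height_le0 w : min_height w <= 0.
Proof.
by have /min_heightP/(_ 0%N isT) := lexx (min_height w); rewrite take0.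
Qed.

Lemma min_height_le w : min_height w <= height w.
Proof.
have /min_heightP/(_ _ (leqnn _)) := lexx (min_height w).
by rewrite take_size.
Qed.

Lemma motzkinE w : motzkin w = (0 <= min_height w) && (height w == 0).
Proof.
rewrite /motzkin andbC; congr (_ && _).
apply/allP/min_heightP => le0 i => [le_iw|].
  by apply: le0; rewrite mem_iota.
by rewrite mem_iota => le_iw; apply: le0; lia.
Qed.

Definition level_path h h' w :=
  (0 <= h%:Z + min_height w) && (h%:Z + height w == h'%:Z).

Lemma level_path_nil h h' : level_path h h' [::] = (h == h').
Proof. by rewrite /level_path /min_height big_ord_recl big_ord0 /= addr0. Qed.

Lemma level_path_cat h k h' u v :
  level_path h k u -> level_path h h' (u ++ v) = level_path k h' v.
Proof.
rewrite /level_path => /andP[le_u /eqP hk]; rewrite height_cat addrA hk.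
have le0_addr (j : nat) x : (0 <= j%:Z + x) = (- j%:Z <= x) by lia.
by rewrite !le0_addr le_min_height_cat; congr (_ && _); lia.
Qed.

(* The depth of a step is measured from its lower endpoint, which is at level
   [minn h h']. *)
Lemma level_path_step h h' w : reduces_to_step w -> -1 <= depth w ->
  level_path h h' w =
  (height w == h'%:Z - h%:Z) && ((0 < minn h h')%N || (depth w == 0)).
Proof.
rewrite /reduces_to_step /reduces_to_up /reduces_to_horizontal /reduces_to_down.
rewrite /depth /level_path /reduces_to_down => step_w.
by have := min_height_le0 w; have := min_height_le w; case: ifP; lia.
Qed.

Definition adjacent_levels h : seq nat :=
  if h is k.+1 then [:: k; k.+1; k.+2] else [:: 0; 1]%N.

Lemma level_path_adjacent h h' w :
  reduces_to_step w -> level_path h h' w -> h' \in adjacent_levels h.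
Proof.
rewrite /reduces_to_step /reduces_to_up /reduces_to_down /reduces_to_horizontal.
by rewrite /level_path; case: h => [|h]; rewrite /= !inE; lia.
Qed.

Lemma level_path_cat_sum (R : comNzRingType) h h' u v : reduces_to_step u ->
  (level_path h h' (u ++ v))%:R =
  \sum_(k <- adjacent_levels h)
    (level_path h k u)%:R * (level_path k h' v)%:R :> R.
Proof.
move=> step_u; pose k := absz (h%:Z + height u).
have end_u j : level_path h j u = level_path h k u && (j == k).
  by have := min_height_le u; rewrite /level_path /k; lia.
have [path_u|nopath_u] := boolP (level_path h k u).
  rewrite (level_path_cat _ _ path_u) (bigD1_seq k) /=.
  - rewrite path_u mul1r big1 ?addr0 // => j /negPf jk.
    by rewrite end_u jk andbF mul0r.
  - exact: level_path_adjacent step_u path_u.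
  - by case: (h) => [|h0] /=; rewrite ?inE; lia.
rewrite big1 => [|j _]; last by rewrite end_u (negPf nopath_u) mul0r.
suff /negPf-> : ~~ level_path h h' (u ++ v) by [].
apply: contra nopath_u; rewrite /level_path height_cat => /andP[le_uv _].
have le_u : - h%:Z <= min_height u.
  have : - h%:Z <= min_height (u ++ v) by lia.
  by rewrite le_min_height_cat => /andP[].
by have := min_height_le u; rewrite /k; lia.
Qed.

Lemma letter_step a : reduces_to_step [:: a].
Proof.
rewrite /reduces_to_step /reduces_to_up /reduces_to_down /reduces_to_horizontal.
by rewrite height_letter; case: a.
Qed.

Lemma depth_letter a : depth [:: a] = 0.
Proof.
rewrite /depth /reduces_to_down /min_height 2!big_ord_recl big_ord0 /=.
by rewrite height_letter; case: a.
Qed.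

(** * Generating functions of clusters and blocks *)

Section ClusterSeries.
Variable S : {fset word}.

Lemma cluster_gfE (P : pred word) :
  cluster_gf S P = word_gf (fun w => (P w)%:R * cluster_weight S w).
Proof.
apply/fpsP => n; rewrite /= big_mkcond; apply: eq_bigr => w _.
by rewrite mulr_natl mulrb.
Qed.

Lemma cluster_weight_neq0 w :
  cluster_weight S w != 0 -> exists M, cluster S w M.
Proof.
move=> weight_neq0; suff: has (cluster S w) (fpowerset (occ S w)).
  by case/hasP=> M _ clM; exists M.
by apply: contraNT weight_neq0 => nocluster; rewrite /cluster_weight big_hasC.
Qed.

Lemma eq_cluster_gf (P Q : pred word) :
  (forall w M, cluster S w M -> P w = Q w) -> cluster_gf S P = cluster_gf S Q.
Proof.
move=> PQ; rewrite !cluster_gfE; apply: eq_word_gf => w.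
have [->|] := eqVneq (cluster_weight S w) 0; first by rewrite !mulr0.
by case/cluster_weight_neq0=> M /PQ->.
Qed.

Lemma cluster_gf_andbT (P : pred word) :
  cluster_gf S (fun w => P w && true) = cluster_gf S P.
Proof. by apply: eq_cluster_gf => w M _; rewrite andbT. Qed.

Hypothesis S_nonempty_words : [::] \notin S.

Lemma block_gfE (P : pred word) :
  word_gf (fun w => (P w)%:R * block_weight S w) =
  xvar * fpsC (\sum_(a | P [:: a]) letter_weight a) + cluster_gf S P.
Proof.
rewrite cluster_gfE big_mkcond /= -word_gf_letter -word_gfD.
apply: eq_word_gf => w.
rewrite block_weightE // mulrDr; congr (_ + _).
by case: w => [|a [|b w]]; rewrite ?mulr0 // mulr_natl mulrb.
Qed.

Lemma xvar_cluster_gf_neq0 (P : pred word) : xvar + cluster_gf S P != 0.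
Proof.
apply/eqP => /fpsP/(_ 1%N)/(congr1 (fun p : Qtz => p`_0))/eqP.
rewrite coef_fpsD coef_fps0 coefD coef0 /= coef1 coef_sum.
rewrite big1 ?addr0 ?oner_eq0 // => w _; rewrite coef_sum big1 // => M.
move=> /(clusterP _ _ S_nonempty_words)[_ _ M0 _].
by rewrite /tz_monom coef0M coefXn eq_sym cardfs_eq0 (negPf M0) mul0r.
Qed.

Hypothesis S_clusters : forall (w : word) (M : {fset nat * word}),
  cluster S w M -> reduces_to_step w /\ -1 <= depth w.

Lemma block_weight_step w : block_weight S w != 0 -> reduces_to_step w.
Proof.
rewrite block_weightE //; case: w => [|a [|b w]]; rewrite ?letter_step // add0r.
by case/cluster_weight_neq0=> M /S_clusters[].
Qed.

Definition step_gf h h' : fps Qtz :=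
  word_gf (fun w => (level_path h h' w)%:R * block_weight S w).

Definition path_gf h : fps Qtz :=
  word_gf (fun w => (level_path h 0 w)%:R * marked_weight S w).

Lemma step_gfE a h h' : height [:: a] = h'%:Z - h%:Z ->
  step_gf h h' = xvar * fpsC (letter_weight a) +
    cluster_gf S (fun w => (height w == height [:: a]) &&
                           ((0 < minn h h')%N || (depth w == 0))).
Proof.
move=> height_a; rewrite /step_gf block_gfE; congr (_ * fpsC _ + _).
  apply: big_pred1 => b.
  rewrite level_path_step ?letter_step ?depth_letter // eqxx orbT andbT.
  rewrite -height_a !height_letter /= letter_eqE.
  by case: a b {height_a} => -[].
apply: eq_cluster_gf => w M /S_clusters[step_w depth_w].
by rewrite level_path_step // height_a.
Qed.

Lemma step_gf_up h : step_gf h h.+1 =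
  xvar +
  cluster_gf S (fun w => reduces_to_up w && ((0 < h)%N || (depth w == 0))).
Proof.
rewrite (@step_gfE U) ?height_letter; last by lia.
by rewrite fpsC1 mulr1 (minn_idPl (leqnSn h)).
Qed.

Lemma step_gf_down h : step_gf h.+1 h =
  xvar +
  cluster_gf S (fun w => reduces_to_down w && ((0 < h)%N || (depth w == 0))).
Proof.
rewrite (@step_gfE D) ?height_letter; last by lia.
by rewrite fpsC1 mulr1 (minn_idPr (leqnSn h)).
Qed.

Lemma step_gf_horizontal h : step_gf h h =
  xvar * zvar + cluster_gf S (fun w =>
    reduces_to_horizontal w && ((0 < h)%N || (depth w == 0))).
Proof.
rewrite (@step_gfE H) ?height_letter; last by lia.
by rewrite minnn.
Qed.

Lemma marked_path_weight_conv h w :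
  (level_path h 0 w)%:R * marked_weight S w =
  (if w is [::] then (h == 0%N)%:R else 0) +
  \sum_(k <- adjacent_levels h)
    word_conv (fun u => (level_path h k u)%:R * block_weight S u)
              (fun v => (level_path k 0 v)%:R * marked_weight S v) w.
Proof.
rewrite marked_weight_conv mulrDr; congr (_ + _).
  by case: w => [|a w]; rewrite ?mulr0 // mulr1 level_path_nil.
rewrite exchange_big mulr_sumr; apply: eq_bigr => i _ /=.
rewrite -{1}(cat_take_drop i w).
have [->|/block_weight_step step_u] := eqVneq (block_weight S (take i w)) 0.
  by rewrite mul0r mulr0 big1 // => k _; rewrite mulr0 mul0r.
rewrite level_path_cat_sum // mulr_suml; apply: eq_bigr => k _.
by rewrite mulrACA.
Qed.

Lemma path_gf_rec h : path_gf h =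
  fpsC (h == 0%N)%:R + \sum_(k <- adjacent_levels h) step_gf h k * path_gf k.
Proof.
rewrite {1}/path_gf (eq_word_gf (marked_path_weight_conv h)).
rewrite word_gfD word_gf_nil word_gf_sum; congr (_ + _).
by apply: eq_bigr => k _; apply: word_gf_conv.
Qed.

Lemma path_gf_level0 : path_gf 0 =
  1 + (xvar * zvar + A'_H S) * path_gf 0 + (xvar + A'_U S) * path_gf 1.
Proof.
rewrite {1}path_gf_rec !big_cons big_nil addr0 addrA fpsC1.
by rewrite step_gf_horizontal step_gf_up.
Qed.

Lemma step_gf_up_above h : step_gf h.+1 h.+2 = xvar + A_U S.
Proof. by rewrite step_gf_up /A_U -(cluster_gf_andbT reduces_to_up). Qed.

Lemma step_gf_down_above h : step_gf h.+2 h.+1 = xvar + A_D S.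
Proof. by rewrite step_gf_down /A_D -(cluster_gf_andbT reduces_to_down). Qed.

Lemma step_gf_horizontal_above h : step_gf h.+1 h.+1 = xvar * zvar + A_H S.
Proof.
rewrite step_gf_horizontal /A_H.
by rewrite -(cluster_gf_andbT reduces_to_horizontal).
Qed.

Lemma path_gf_level1 : path_gf 1 =
  (xvar + A'_D S) * path_gf 0 + (xvar * zvar + A_H S) * path_gf 1
  + (xvar + A_U S) * path_gf 2.
Proof.
rewrite {1}path_gf_rec !big_cons big_nil fpsC0 add0r addr0 addrA.
by rewrite step_gf_down step_gf_horizontal_above step_gf_up_above.
Qed.

Lemma path_gf_above h : path_gf h.+2 =
  (xvar + A_D S) * path_gf h.+1 + (xvar * zvar + A_H S) * path_gf h.+2
  + (xvar + A_U S) * path_gf h.+3.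
Proof.
rewrite {1}path_gf_rec !big_cons big_nil fpsC0 add0r addr0 addrA.
by rewrite step_gf_down_above step_gf_horizontal_above step_gf_up_above.
Qed.

End ClusterSeries.

Lemma shift_t_motzkin_gf S : shift_t (motzkin_gf S) = path_gf S 0.
Proof.
apply/fpsP => n; rewrite /= raddf_sum big_mkcond; apply: eq_bigr => w _ /=.
by rewrite -marked_weightE mulr_natl mulrb motzkinE /level_path !add0r.
Qed.

Theorem theorem7p1 (S : {fset word})
  (S_nonempty_words : [::] \notin S)
  (S_reduced : forall v w : word, v \in S -> w \in S -> infix v w -> v = w)
  (S_clusters : forall (w : word) (M : {fset nat * word}),
     cluster S w M -> reduces_to_step w /\ -1 <= depth w) :
  let x := xvar in
  let z := zvar in
  let l := x * z + A_H S in
  let l' := x * z + A'_H S in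
  let y := x + A_U S in
  let y' := x + A'_U S in
  let s := x + A_D S in
  let s' := x + A'_D S in
  tofrac (shift_t (motzkin_gf S)) =
    tofrac (2%:R * y * s) /
    tofrac (2%:R * (1 - l') * y * s - y' * s' + y' * s' * l
            + y' * s' * fps_sqrt ((1 - l) ^+ 2 - 4%:R * y * s))
    :> {fraction fps Qtz}.
Proof.
move=> x z l l' y y' s s'.
have two_neq0 : 2%:R != 0 :> Qtz.
  by apply: contraTneq Qtz_unit2 => ->; rewrite unitr0.
have l0 : fpscoef l 0 = 0.
  by rewrite coef_fpsD cluster_gf_coef0 coef0_fpsM mul0r addr0.
have y0 : fpscoef y 0 = 0 by rewrite coef_fpsD cluster_gf_coef0 addr0.
have disc0 : fpscoef ((1 - l) ^+ 2 - 4%:R * y * s) 0 = 1.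
  rewrite coef_fpsD coef_fpsN expr2 !coef0_fpsM coef_fpsD coef_fpsN l0 y0.
  by rewrite mulr0 mul0r !subr0 mulr1.
apply: tofrac_div_eq.
  by rewrite !mulf_neq0 ?xvar_cluster_gf_neq0 ?fps_natr_neq0.
rewrite shift_t_motzkin_gf; apply: level_system_solution => //.
- exact: fps_sqrt_sqr Qtz_unit2 disc0.
- exact: path_gf_level0.
- exact: path_gf_level1.
- exact: path_gf_above.
Qed.
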